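(* Let $y:[0,\tau_f]\to\mathbb{R}^{n_y}$, $y(\tau)=(q(\tau),v(\tau),t(\tau))$, be a solution of the time-freezing system $y'\in F_{\mathrm{TF}}(y,u)$ with $y(0)\in\Sigma$, and suppose that $\varphi(x(\tau),u(\tau))\le 0$ for all $\tau\in[0,\tau_f]$ (persistent contact). Then: (i) the convex multipliers $\theta_1,\theta_2\ge 0$ in the representation $y'=\theta_1 f_1(y,u)+\theta_2 f_2(y)$, $\theta_1+\theta_2=1$, are unique; (ii) the dynamics of the sliding mode are given by $y'=\gamma(x,u)\,(f_{\mathrm{DAE}}(x,u),1)$, where $\gamma(x,u)\in(0,1]$ is the time-rescaling factor $$\gamma(x,u):=\frac{D(q)a_{\mathrm{n}}}{D(q)a_{\mathrm{n}}-\varphi(x,u)}.$$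
   Context: Let $f_v:\mathbb{R}^{n_q}\times\mathbb{R}^{n_q}\times\mathbb{R}^{n_u}\to\mathbb{R}^{n_q}$, $M:\mathbb{R}^{n_q}\to\mathbb{R}^{n_q\times n_q}$ and $f_c:\mathbb{R}^{n_q}\to\mathbb{R}$ be at least twice continuously differentiable, with $M(q)$ symmetric positive definite. Let $x=(q,v)\in\mathbb{R}^{2n_q}$, $n(q):=\nabla_q f_c(q)$, $D(q):=n(q)^\top M(q)^{-1}n(q)$ (so $D(q)>0$ when $n(q)\neq0$), $\varphi(x,u):=n(q)^\top f_v(q,v,u)+\nabla_q\big(n(q)^\top v\big)^\top v$, $f_{\mathrm{ODE}}(x,u):=(v,f_v(q,v,u))$ and $f_{\mathrm{DAE}}(x,u):=\big(v,\ f_v(q,v,u)-M(q)^{-1}n(q)D(q)^{-1}\varphi(x,u)\big)$. The time-freezing state is $y=(x,t)\in\mathbb{R}^{n_y}$, $n_y=2n_q+1$, where $t$ is a clock state, evolving in numerical time $\tau$ with $y'=\mathrm{d}y/\mathrm{d}\tau$, and $u(\tau)\in\mathbb{R}^{n_u}$ is a given control function. Switching functions: $c_1(y)=f_c(q)$, $c_2(y)=n(q)^\top v$. Regions: $R_1=\{y: c_1(y)>0\}\cup\{y: c_1(y)<0,\ c_2(y)>0\}$, $R_2=\{y: c_1(y)<0,\ c_2(y)<0\}$. Vector fields: $f_1(y,u)=(f_{\mathrm{ODE}}(x,u),1)$ and $f_2(y)=f_{\mathrm{aux,n}}(y):=(\mathbf{0}_{n_q,1},\ M(q)^{-1}n(q)a_{\mathrm{n}},\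 0)$ with a constant $a_{\mathrm{n}}>0$. The time-freezing system is the Filippov differential inclusion $$y'\in F_{\mathrm{TF}}(y,u):=\{\theta_1 f_1(y,u)+\theta_2 f_2(y)\mid \theta_1+\theta_2=1,\ \theta\ge0,\ \theta_i=0 \text{ if } y\notin\overline{R_i},\ i=1,2\}.$$ Define $\Sigma:=\{y\in\mathbb{R}^{n_y}\mid f_c(q)=0,\ n(q)^\top v=0\}$. A sliding mode is an evolution of $y$ on $\Sigma$. *)

(* Defs.v *)
From mathcomp Require Import all_boot all_order all_algebra.
From mathcomp Require Import all_classical all_reals all_analysis.
Import Order.TTheory GRing.Theory Num.Theory.
Import numFieldNormedType.Exports.
Local Open Scope ring_scope.
Local Open Scope classical_set_scope.

Set Implicit Arguments.
Unset Strict Implicit.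
Unset Printing Implicit Defensive.

Section TimeFreezing.
Context {R : realType}.

Definition C2 {X Y : normedModType R} (f : X -> Y) : Prop :=
  (forall x, differentiable f x) /\
  (forall (e : X) x, differentiable ('D_e f) x) /\
  (forall e1 e2 : X, continuous ('D_e2 ('D_e1 f))).

Definition abs_cont {Y : normedModType R} (a b : R) (f : R -> Y) : Prop :=
  forall eps : R, 0 < eps -> exists2 delta : R, 0 < delta &
    forall (k : nat) (s : 'I_k -> R * R),
      (forall i, a <= (s i).1 /\ (s i).1 <= (s i).2 /\ (s i).2 <= b) ->
      (forall i j, i != j -> (s i).2 <= (s j).1 \/ (s j).2 <= (s i).1) ->
      \sum_(i < k) ((s i).2 - (s i).1) < delta ->
      \sum_(i < k) `|f (s i).2 - f (s i).1| < eps.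

Context {nq nu : nat}.
Local Notation V := 'cV[R]_nq.
Local Notation U := 'cV[R]_nu.
(* time-freezing state y = (q, v, t), encoded as ((q, v), t) *)
Local Notation state := (V * V * R)%type.

Definition dotv (a b : V) : R := (a^T *m b) 0 0.

Definition grad (g : V -> R) (q : V) : V := \col_i ('D_(delta_mx i 0) g q).

Definition posdef (A : 'M[R]_nq) : Prop :=
  forall x : V, x != 0 -> 0 < dotv x (A *m x).

Definition nvec (fc : V -> R) (q : V) : V := grad fc q.

Definition Dfun (M : V -> 'M[R]_nq) (fc : V -> R) (q : V) : R :=
  dotv (nvec fc q) (invmx (M q) *m nvec fc q).

Definition phi (fv : V -> V -> U -> V) (fc : V -> R) (q v : V) (w : U) : R :=
  dotv (nvec fc q) (fv q v w) + dotv (grad (fun q' => dotv (nvec fc q') v) q) v.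

Definition fODE (fv : V -> V -> U -> V) (q v : V) (w : U) : V * V :=
  (v, fv q v w).

Definition fDAE (fv : V -> V -> U -> V) (M : V -> 'M[R]_nq) (fc : V -> R)
    (q v : V) (w : U) : V * V :=
  (v, fv q v w - (invmx (M q) *m nvec fc q) *m
                   ((Dfun M fc q)^-1 *: (phi fv fc q v w)%:M)).

Definition c1 (fc : V -> R) (y : state) : R := fc y.1.1.
Definition c2 (fc : V -> R) (y : state) : R := dotv (nvec fc y.1.1) y.1.2.

Definition Reg1 (fc : V -> R) : set state :=
  [set y | 0 < c1 fc y] `|` [set y | c1 fc y < 0 /\ 0 < c2 fc y].
Definition Reg2 (fc : V -> R) : set state :=
  [set y | c1 fc y < 0 /\ c2 fc y < 0].

Definition f1 (fv : V -> V -> U -> V) (y : state) (w : U) : state :=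
  (fODE fv y.1.1 y.1.2 w, 1).
Definition f2 (M : V -> 'M[R]_nq) (fc : V -> R) (an : R) (y : state) : state :=
  ((0, (invmx (M y.1.1) *m nvec fc y.1.1) *m an%:M), 0).

Definition F_TF (fv : V -> V -> U -> V) (M : V -> 'M[R]_nq) (fc : V -> R)
    (an : R) (y : state) (w : U) : set state :=
  [set dy | exists th1 th2 : R,
     [/\ 0 <= th1, 0 <= th2 & th1 + th2 = 1] /\
     [/\ (~ closure (Reg1 fc) y -> th1 = 0),
         (~ closure (Reg2 fc) y -> th2 = 0) &
         dy = th1 *: f1 fv y w + th2 *: f2 M fc an y]].

Definition Sigma (fc : V -> R) : set state :=
  [set y | fc y.1.1 = 0 /\ dotv (nvec fc y.1.1) y.1.2 = 0].

Definition TF_solution (fv : V -> V -> U -> V) (M : V -> 'M[R]_nq)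
    (fc : V -> R) (an : R) (u : R -> U) (tauf : R) (y : R -> state) : Prop :=
  abs_cont 0 tauf y /\
  \forall tau \ae (@lebesgue_measure R), 0 <= tau <= tauf ->
     derivable y tau 1 /\ F_TF fv M fc an (y tau) (u tau) (y^`() tau).

Definition gamma (fv : V -> V -> U -> V) (M : V -> 'M[R]_nq) (fc : V -> R)
    (an : R) (q v : V) (w : U) : R :=
  Dfun M fc q * an / (Dfun M fc q * an - phi fv fc q v w).

End TimeFreezing.

(* Main.v *)
(* Along a solution with multipliers th1, th2 one has almost everywhere
   c1' = th1 c2 and c2' = th1 phi + th2 D an.  On {c2 > 0} only R_1 is adjacent, so
   c2' = phi <= 0 and c2 can never become positive; hence c1' <= 0 and c1 <= 0.
   Where c2 < 0, either c1 < 0, and only R_2 is adjacent, or c1 = 0 is an interior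
   maximum, so that th1 c2 = c1' = 0; in both cases th1 = 0 and c2' = D an >= 0, so
   c2 cannot become negative either.  Thus c2 = 0, then c1' = 0 and c1 = 0.
   Finally c2' = 0 determines th1 = gamma.
   Passing from the sign of an almost everywhere derivative to monotonicity uses
   absolute continuity: a Cousin division is tagged either by good points or by
   points of a null set covered by an open set of small measure. *)
Require Import Defs.
From mathcomp Require Import all_boot all_order all_algebra.
From mathcomp Require Import all_classical all_reals all_analysis.
From mathcomp Require Import measurable_realfun ring lra.
Import Order.TTheory GRing.Theory Num.Theory.
Import numFieldNormedType.Exports.
Local Open Scope ring_scope.
Local Open Scope classical_set_scope.

Set Implicit Arguments.
Unset Strict Implicit.
Unset Printing Implicit Defensive.

(** * Monotonicity of absolutely continuous functions *)

(** Cousin's lemma as an induction principle. The supremum [c] of the points reached from [a] is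
    itself reached, because the local hypothesis at [c] bridges the gap below it; the same
    hypothesis carries past [c] unless [c = b]. *)
Lemma cousin_induction (R : realType) (P : R -> R -> Prop) (a b : R) :
  a <= b ->
  (forall s m t, a <= s -> s <= m -> m <= t -> t <= b ->
     P s m -> P m t -> P s t) ->
  (forall x, a <= x <= b -> exists2 r : R, 0 < r &
     forall s t, a <= s -> s <= x -> x <= t -> t <= b ->
       x - r < s -> t < x + r -> P s t) ->
  P a b.
Proof.
move=> ab Padd Ploc.
pose S := [set x | a <= x <= b /\ P a x].
(* The base case [P a a] is the local hypothesis at [a] on a degenerate interval. *)
have Sa : S a.
  split; first by rewrite lexx ab.
  have [|r r0] := Ploc a; first by rewrite lexx ab.
  apply; rewrite ?lexx //; lra.
have ubS : ubound S b by move=> x [/andP[]].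
have supS : has_sup S by split; [exists a | exists b].
have le_supS x : S x -> x <= sup S by apply: ub_le_sup; exists b.
have acb : a <= sup S <= b.
  apply/andP; split; first exact: le_supS.
  by apply: ge_sup => //; exists a.
have [r r0 Pr] := Ploc _ acb; move: (acb) => /andP[ac cb].
have [s [/andP[as_ sb] Pas] crs] := sup_adherent r0 supS.
have sc : s <= sup S by apply: le_supS; rewrite /S/= as_ sb.
have Pac : P a (sup S).
  by apply: (Padd a s) => //; apply: Pr => //; lra.
have [cltb|] := ltP (sup S) b; last first.
  by move=> bc; have <- : sup S = b by apply/eqP; rewrite eq_le cb bc.
pose t := Num.min b (sup S + r / 2).
have ct : sup S < t by rewrite lt_min cltb /=; lra.
have tb : t <= b by rewrite ge_min lexx.
have tr : t <= sup S + r / 2 by rewrite ge_min lexx orbT.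
have : t <= sup S.
  apply: le_supS.
  split; first by rewrite tb andbT; lra.
  by apply: (Padd a (sup S)) => //; [lra | apply: Pr => //; lra].
lra.
Qed.

(** Increments of [h] are compared with those of [y], so [y] is asked for accuracy [e / (|L| + 1)];
    the added 1 keeps the divisor positive. *)
Lemma abs_cont_lipschitz (R : realType) (Y : normedModType R) (a b a' b' L : R)
    (y : R -> Y) (h : R -> R) :
  abs_cont a b y -> a <= a' -> b' <= b ->
  (forall s t, a' <= s -> s <= t -> t <= b' ->
     `|h t - h s| <= L * `|y t - y s|) ->
  abs_cont a' b' h.
Proof.
move=> acy aa' bb' hL e e0.
have L0 : 0 < `|L| + 1 by rewrite ltr_wpDl.
have [d d0 yd] := acy (e / (`|L| + 1)) (divr_gt0 e0 L0).
exists d => // k s sI sD sd.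
have {yd} : \sum_(i < k) `|y (s i).2 - y (s i).1| < e / (`|L| + 1).
  apply: yd => // i; have [? [? ?]] := sI i; split; [|split] => //; lra.
rewrite ltr_pdivlMr// mulrC mulr_sumr; apply: le_lt_trans.
apply: ler_sum => i _; have [? [? ?]] := sI i.
apply: le_trans (hL _ _ _ _ _) _ => //.
by apply: ler_wpM2r => //; rewrite (le_trans (ler_norm L))// lerDl.
Qed.

(** Sorted lists replace indexed families because the divisions built below are glued by
    concatenation. *)
Lemma abs_cont_pairwise (R : realType) (Y : normedModType R) (a b : R)
    (f : R -> Y) :
  abs_cont a b f -> forall eps : R, 0 < eps -> exists2 delta : R, 0 < delta &
    forall l : seq (R * R),
      (forall p, p \in l -> [/\ a <= p.1, p.1 <= p.2 & p.2 <= b]) ->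
      pairwise (fun p q => p.2 <= q.1) l ->
      \sum_(p <- l) (p.2 - p.1) < delta ->
      \sum_(p <- l) `|f p.2 - f p.1| < eps.
Proof.
move=> acf e e0; have [d d0 fd] := acf e e0; exists d => // l lI lP ld.
pose s := tnth (in_tuple l).
rewrite big_tnth; rewrite big_tnth in ld; apply: fd ld.
  by move=> i; have [] := lI _ (mem_tnth i (in_tuple l)).
move=> i j ij; rewrite !(tnth_nth (0, 0)) /=.
have /pairwiseP := lP; move/(_ (0, 0)) => lP'.
by case: (ltngtP i j) ij => [ij _|ij _|/val_inj ->];
  [left|right|rewrite eqxx]; rewrite // lP'// inE ltn_ord.
Qed.

(** Outer regularity of a measurable null superset [A]: removing [A] from [U] does not change the
    measure of [U]. *)
Lemma negligible_open_cover (R : realType) (N : set R) (eps : R) :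
  (@lebesgue_measure R).-negligible N -> 0 < eps ->
  exists U : set R, [/\ open U, N `<=` U & (lebesgue_measure U < eps%:E)%E].
Proof.
move=> [A [mA A0' NA]] e0.
pose mu : set R -> \bar R := @lebesgue_measure R.
have A0 : mu A = 0%E by exact: A0'.
have Aoo : (mu A < +oo)%E by rewrite A0.
have [U [oU AU UA]] := lebesgue_regularity_outer mA Aoo e0.
exists U; split => //; first exact: subset_trans NA AU.
have mU : measurable U := open_measurable oU.
suff -> : lebesgue_measure U = lebesgue_measure (U `\` A) by [].
rewrite -{1}(setDUK AU) measureU//; last 2 first.
- exact: measurableD.
- by rewrite setDIK.
by rewrite -[RHS]add0e; congr (_ + _)%E.
Qed.

(** The straddle lemma: the tag [x] splits the increment into two one-sided ones, whose errors
    [eps * (t - x)] and [eps * (x - s)] add up. *)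
Lemma derivable_straddle (R : realType) (h : R -> R) (x d eps : R) :
  is_derive x 1 h d -> 0 < eps ->
  exists2 r : R, 0 < r & forall s t, s <= x -> x <= t -> x - r < s -> t < x + r ->
    `|h t - h s - d * (t - s)| <= eps * (t - s).
Proof.
move=> [dh hd] e0.
have hc : (fun k => k^-1 *: ((h \o shift x) (k *: 1) - h x)) @ 0^' --> d.
  by rewrite -hd; exact: dh.
move/cvgrPdist_lt: hc => /(_ _ e0)/nbhs_ballP[r /= r0 hr].
have key (k : R) : k != 0 -> `|k| < r -> `|h (x + k) - h x - d * k| <= eps * `|k|.
  move=> k0 kr; have /= := hr k; rewrite /ball /= sub0r normrN => /(_ kr k0).
  rewrite /GRing.scale /= mulr1 [k + x]addrC => /ltW.
  rewrite -(ler_pM2r (_ : 0 < `|k|)) ?normr_gt0// -normrM; apply: le_trans.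
  by rewrite mulrBl mulrAC mulVf// mul1r distrC.
exists r => // s t sx xt rs tr.
have h1 : `|h t - h x - d * (t - x)| <= eps * (t - x).
  have [<-|xt'] := eqVneq x t; first by rewrite !subrr !mulr0 subr0 normr0.
  have tx : 0 < t - x by rewrite subr_gt0 lt_neqAle xt' xt.
  have := key (t - x); rewrite gt_eqF// gtr0_norm// subrKC => /(_ isT); apply; lra.
have h2 : `|h s - h x - d * (s - x)| <= eps * (x - s).
  have [->|xs'] := eqVneq x s; first by rewrite !subrr !mulr0 subr0 normr0.
  have tx : 0 < x - s by rewrite subr_gt0 lt_neqAle eq_sym xs' sx.
  have := key (s - x); rewrite subr_eq0 eq_sym xs' distrC gtr0_norm// subrKC.
  by move=> /(_ isT); apply; lra.
move: h1 h2; rewrite !ler_norml; lra.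
Qed.

Lemma is_derive_interior_max (R : realType) (h : R -> R) (a b x d : R) :
  is_derive x 1 h d -> a < x < b -> (forall z, a <= z <= b -> h z <= h x) -> d = 0.
Proof.
move=> hd /andP[ax xb] hmax; apply/eqP; rewrite -normr_le0.
apply/ler_addgt0Pr => e e0; rewrite add0r.
have [r r0 hr] := derivable_straddle hd e0.
(* The step [k] stays within the straddle radius and within [[a, b]] on both sides; the right and
   left increments then give [d <= e] and [- e <= d]. *)
pose k := Num.min (r / 2) (Num.min (x - a) (b - x)).
have k0 : 0 < k by rewrite !lt_min divr_gt0//= !subr_gt0 ax.
have kr : k <= r / 2 by rewrite ge_min lexx.
have ka : k <= x - a by rewrite !ge_min lexx orbT.
have kb : k <= b - x by rewrite !ge_min lexx !orbT.
have hl : h (x - k) <= h x by apply: hmax; lra.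
have hu : h (x + k) <= h x by apply: hmax; lra.
have := hr (x - k) x; have := hr x (x + k).
rewrite (_ : x + k - x = k); last by lra.
rewrite (_ : x - (x - k) = k); last by lra.
rewrite !ler_norml => hr1 hr2.
have {hr1} /andP[hr1 _] := hr1 ltac:(lra) ltac:(lra) ltac:(lra) ltac:(lra).
have {hr2} /andP[_ hr2] := hr2 ltac:(lra) ltac:(lra) ltac:(lra) ltac:(lra).
by apply/andP; split; rewrite -(ler_pM2r k0); lra.
Qed.

(** In a Cousin division, intervals with a good tag lose at most [e] per unit length. The others lie
    in an open set so small that absolute continuity bounds the sum of their increments by [e]. *)
Lemma abs_cont_ge0_derive (R : realType) (a b : R) (h : R -> R) :
  a <= b -> abs_cont a b h ->
  (\forall x \ae (@lebesgue_measure R), a <= x <= b ->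
     exists2 d, is_derive x 1 h d & 0 <= d) ->
  h a <= h b.
Proof.
move=> ab ach hae.
suff key e : 0 < e -> h a - h b <= e * (1 + (b - a)).
  rewrite -subr_le0; apply/ler_addgt0Pr => e e0; rewrite add0r.
  have c0 : 0 < 1 + (b - a) by lra.
  by have := key _ (divr_gt0 e0 c0); rewrite divfK// gt_eqF.
move=> e0; have [d d0 hd] := abs_cont_pairwise ach e0.
have [U [oU NU Ud]] := negligible_open_cover hae d0.
pose mu : set R -> \bar R := @lebesgue_measure R.
(* l collects the division intervals whose tag lies in the null set *)
pose P s t := exists l : seq (R * R),
  [/\ forall p, p \in l -> [/\ s <= p.1, p.1 <= p.2 & p.2 <= t],
      pairwise (fun p q => p.2 <= q.1) l,
      ((\sum_(p <- l) (p.2 - p.1))%:E <= mu (U `&` `[s, t[))%E &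
      h s - h t <= e * (t - s) + \sum_(p <- l) `|h p.2 - h p.1|].
have mU : measurable U := open_measurable oU.
have [l [lI lP lU hl]] : P a b.
  apply: cousin_induction => //.
    move=> s m t as_ sm mt tb [l1 [l1I l1P l1U hl1]] [l2 [l2I l2P l2U hl2]].
    exists (l1 ++ l2); split.
    - move=> p; rewrite mem_cat => /orP[/l1I|/l2I] [? ? ?]; split => //; lra.
    - rewrite pairwise_cat l1P l2P !andbT; apply/allrelP => p q /l1I[? ? ?] /l2I[? ? ?].
      lra.
    (* Adjacent half-open intervals are disjoint, so the measures add exactly. *)
    - have -> : mu (U `&` `[s, t[) =
          (mu (U `&` `[s, m[) + mu (U `&` `[m, t[))%E.
        rewrite /mu -measureU; last 3 first.
        + by apply: measurableI.
        + by apply: measurableI.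
        + rewrite -subset0 => x [] [_ /=] + [_ /=].
          by rewrite !in_itv /= => /andP[_ xm] /andP[mx _]; lra.
        rewrite -setIUr; congr (lebesgue_measure (U `&` _)).
        apply/seteqP; split => x /=; rewrite !in_itv /=.
          move=> /andP[sx xt]; have [xm|mx] := ltP x m; [left|right];
            by apply/andP; split.
        by move=> [] /andP[? ?]; apply/andP; split; lra.
      by rewrite big_cat /= EFinD leeD.
    - rewrite big_cat /=; lra.
  move=> x /andP[ax xb].
  (* A tag with nonnegative derivative puts nothing into [l]: the straddle estimate alone bounds the
     loss. *)
  have [xN|xN] := pselect (a <= x <= b -> exists2 d, is_derive x 1 h d & 0 <= d).
    have [|k hk k0] := xN; first by rewrite ax xb.
    have [r r0 hr] := derivable_straddle hk e0.
    exists r => // s t as_ sx xt tb rs tr; exists [::]; split => //.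
      by rewrite big_nil measure_ge0.
    rewrite big_nil; have := hr s t sx xt rs tr; rewrite ler_norml.
    have : 0 <= k * (t - s) by apply: mulr_ge0; lra.
    lra.
  (* At an exceptional tag, openness puts the whole half-open interval inside [U], so its length
     equals the measure charged in [P]. *)
  have /nbhs_ballP[r /= r0 rU] : nbhs x U by apply: open_nbhs_nbhs; split => //; exact: NU.
  exists r => // s t as_ sx xt tb rs tr; exists [:: (s, t)]; split => //.
  - by move=> p; rewrite inE => /eqP -> /=; split => //; lra.
  - rewrite big_seq1 /=; have -> : U `&` `[s, t[ = `[s, t[%classic.
      apply/setIidPr => z /=; rewrite in_itv /= => /andP[sz zt].
      by apply: rU; rewrite /ball /= ltr_norml; lra.
    rewrite /mu lebesgue_measure_itv /= lte_fin.
    by case: ltP => // ts; rewrite lee_fin; lra.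
  - rewrite big_seq1 /=; have := ler_norm (h s - h t).
    rewrite distrC; have : 0 <= e * (t - s) by apply: mulr_ge0; lra.
    lra.
have : \sum_(p <- l) `|h p.2 - h p.1| < e.
  apply: hd => //; rewrite -lte_fin; apply: le_lt_trans lU _.
  apply: le_lt_trans Ud; apply: le_measure; rewrite ?inE //.
  by apply: measurableI.
lra.
Qed.

(** * Locally Lipschitz functions *)

(** Both points vary in the ball: along a curve, increments are taken between two times, neither of
    which need be the tag. *)
Definition locally_lipschitz_at (R : realType) (X : normedModType R)
    (g : X -> R) (x : X) : Prop :=
  exists L r : R, [/\ 0 <= L, 0 < r & forall a b, ball x r a -> ball x r b ->
    `|g a - g b| <= L * `|a - b|].

Lemma locally_lipschitz_cst (R : realType) (X : normedModType R) (c : R) (x : X) :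
  locally_lipschitz_at (fun=> c) x.
Proof. by exists 0, 1; split => // a b _ _; rewrite subrr normr0 mul0r. Qed.

Lemma locally_lipschitzD (R : realType) (X : normedModType R) (f g : X -> R) x :
  locally_lipschitz_at f x -> locally_lipschitz_at g x ->
  locally_lipschitz_at (fun z => f z + g z) x.
Proof.
move=> [L [r [L0 r0 fL]]] [L' [r' [L'0 r'0 gL]]].
exists (L + L'), (Num.min r r'); split; [exact: addr_ge0 | by rewrite lt_min r0|].
move=> a b xa xb; have le_r : Num.min r r' <= r by rewrite ge_min lexx.
have le_r' : Num.min r r' <= r' by rewrite ge_min lexx orbT.
rewrite mulrDl opprD addrACA; apply: le_trans (ler_normD _ _) (lerD _ _).
- by apply: fL; exact: le_ball le_r _ _.
- by apply: gL; exact: le_ball le_r' _ _.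
Qed.

Lemma locally_lipschitz_sum (R : realType) (X : normedModType R) n
    (f : 'I_n -> X -> R) x :
  (forall i, locally_lipschitz_at (f i) x) ->
  locally_lipschitz_at (fun z => \sum_i f i z) x.
Proof.
elim: n f => [|n IH] f fL.
  rewrite (_ : (fun z => _) = fun=> 0); first exact: locally_lipschitz_cst.
  by apply/funext => z; rewrite big_ord0.
rewrite (_ : (fun z => _) =
  fun z => \sum_i f (widen_ord (leqnSn n) i) z + f ord_max z).
  by apply: locally_lipschitzD => //; apply: IH.
by apply/funext => z; rewrite big_ord_recr.
Qed.

Lemma locally_lipschitzM (R : realType) (X : normedModType R) (f g : X -> R) x :
  locally_lipschitz_at f x -> locally_lipschitz_at g x ->
  locally_lipschitz_at (fun z => f z * g z) x.
Proof.
move=> [L [r [L0 r0 fL]]] [L' [r' [L'0 r'0 gL]]].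
(* Bounds for [f] and [g] on their balls: the value at the centre plus the largest Lipschitz
   variation. *)
pose B := `|f x| + L * r; pose B' := `|g x| + L' * r'.
have B0 : 0 <= B by rewrite addr_ge0// mulr_ge0// ltW.
have B'0 : 0 <= B' by rewrite addr_ge0// mulr_ge0// ltW.
have fB a : ball x r a -> `|f a| <= B.
  move=> xa; rewrite -(subrK (f x) (f a)) addrC.
  apply: le_trans (ler_normD _ _) (lerD _ _) => //.
  apply: le_trans (fL _ _ xa (ballxx _ r0)) _; apply: ler_wpM2l => //.
  by move: xa; rewrite -ball_normE /= distrC => /ltW.
have gB a : ball x r' a -> `|g a| <= B'.
  move=> xa; rewrite -(subrK (g x) (g a)) addrC.
  apply: le_trans (ler_normD _ _) (lerD _ _) => //.
  apply: le_trans (gL _ _ xa (ballxx _ r'0)) _; apply: ler_wpM2l => //.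
  by move: xa; rewrite -ball_normE /= distrC => /ltW.
exists (B * L' + B' * L), (Num.min r r'); split.
- by rewrite addr_ge0// mulr_ge0.
- by rewrite lt_min r0.
have le_r : Num.min r r' <= r by rewrite ge_min lexx.
have le_r' : Num.min r r' <= r' by rewrite ge_min lexx orbT.
move=> a b /[dup] /(le_ball le_r) xa /(le_ball le_r') xa'.
move=> /[dup] /(le_ball le_r) xb /(le_ball le_r') xb'.
have -> : f a * g a - f b * g b = f a * (g a - g b) + g b * (f a - f b) by ring.
rewrite mulrDl -!mulrA; apply: le_trans (ler_normD _ _) (lerD _ _); rewrite normrM.
- by apply: ler_pM => //; [exact: fB | exact: gL].
- by apply: ler_pM => //; [exact: gB | exact: fL].
Qed.

(** A nonexpansive [p] sends a ball into the ball of the same radius; the case in view is the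
    projection of a state to its position. *)
Lemma locally_lipschitz_comp (R : realType) (X Y : normedModType R)
    (p : X -> Y) (g : Y -> R) x :
  (forall a b, `|p a - p b| <= `|a - b|) ->
  locally_lipschitz_at g (p x) -> locally_lipschitz_at (g \o p) x.
Proof.
move=> p1 [L [r [L0 r0 gL]]]; exists L, r; split => // a b xa xb /=.
have pball c : ball x r c -> ball (p x) r (p c).
  by rewrite -!ball_normE /=; exact: le_lt_trans.
apply: le_trans (gL _ _ (pball _ xa) (pball _ xb)) _.
exact: ler_wpM2l.
Qed.

Lemma ball_segment (R : realType) (X : normedModType R) (x : X) (r : R) a b t :
  ball x r a -> ball x r b -> 0 <= t <= 1 -> ball x r (b + t *: (a - b)).
Proof.
rewrite -!ball_normE /= => xa xb /andP[t0 t1].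
have -> : x - (b + t *: (a - b)) = t *: (x - a) + (1 - t) *: (x - b).
  rewrite scalerBl scale1r addrCA -scalerBr opprB [x - a + _]addrC subrKA.
  by rewrite opprD addrA -scalerN opprB.
apply: le_lt_trans (ler_normD _ _) _; rewrite !normrZ ger0_norm// ger0_norm ?subr_ge0//.
(* The case [t = 0] is separate: the strict bound on the distance from [x] to [a] survives scaling
   by [t] only when [t > 0]. *)
have [->|t0'] := eqVneq t 0; first by rewrite mul0r add0r subr0 mul1r.
have tp : 0 < t by rewrite lt_neqAle eq_sym t0'.
have : t * `|x - a| < t * r by rewrite ltr_pM2l.
have : (1 - t) * `|x - b| <= (1 - t) * r by rewrite ler_wpM2l ?subr_ge0// ltW.
lra.
Qed.

Lemma dotvE (R : realType) n (a b : 'cV[R]_n) : dotv a b = \sum_i a i 0 * b i 0.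
Proof. by rewrite /dotv mxE; apply: eq_bigr => i _; rewrite mxE. Qed.

Lemma derive_grad (R : realType) n (g : 'cV[R]_n -> R) (z w : 'cV[R]_n) :
  differentiable g z -> 'D_w g z = dotv (grad g z) w.
Proof.
move=> dg; rewrite deriveE// {1}(matrix_sum_delta w) linear_sum dotvE.
apply: eq_bigr => i _; rewrite big_ord1 linearZ /= -deriveE// !mxE.
by rewrite mulrC.
Qed.

Lemma is_derive_line (R : realType) (X : normedModType R) (g : X -> R) (b w : X) t :
  differentiable g (b + t *: w) ->
  is_derive t 1 (fun s : R => g (b + s *: w)) ('D_w g (b + t *: w)).
Proof.
move=> /diff_derivable - /(_ w) dg.
have E : (fun h : R => h^-1 *: (((fun s : R => g (b + s *: w)) \o shift t) (h *: 1) -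
           g (b + t *: w))) =
         (fun h : R => h^-1 *: ((g \o shift (b + t *: w)) (h *: w) - g (b + t *: w))).
  apply/funext => h /=; congr (_ *: (g _ - _)).
  by rewrite [h *: 1]mulr1 scalerDl addrCA.
by split; [rewrite /derivable E | rewrite /derive E].
Qed.

(** By continuity each partial derivative stays within 1 of its value at [x] on some ball. The mean
    value theorem on the segment from [b] to [a], which remains in that ball, turns the sum of these
    bounds into a Lipschitz constant. *)
Lemma locally_lipschitz_C1 (R : realType) n (g : 'cV[R]_n -> R) x :
  (forall z, differentiable g z) -> (forall e, continuous ('D_e g)) ->
  locally_lipschitz_at g x.
Proof.
move=> dg cg.
have : \forall z \near x, forall i : 'I_n,
    `|'D_(delta_mx i 0) g z| < `|'D_(delta_mx i 0) g x| + 1.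
  apply: (@filter_forall _ _ (fun i z =>
    `|'D_(delta_mx i 0) g z| < `|'D_(delta_mx i 0) g x| + 1) (nbhs x)) => i.
  have /cvgrPdist_lt/(_ _ ltr01) := cg (delta_mx i 0) x.
  apply: filterS => z /=; rewrite distrC => zx.
  rewrite -(subrK ('D_(delta_mx i 0) g x) ('D_(delta_mx i 0) g z)) addrC.
  by apply: le_lt_trans (ler_normD _ _) _; rewrite ltrD2l.
move=> /nbhs_ballP[r /= r0 xr].
exists (\sum_i (`|'D_(delta_mx i 0) g x| + 1)), r; split => //.
  by apply: sumr_ge0 => i _; rewrite addr_ge0.
move=> a b xa xb.
have D (t : R) : is_derive t 1 (fun s : R => g (b + s *: (a - b)))
    ('D_(a - b) g (b + t *: (a - b))) by exact: is_derive_line.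
have [|c] := @MVT_segment R _ _ 0 1 ler01 (fun t _ => D t).
  apply: continuous_subspaceT => t; apply: differentiable_continuous.
  by apply/derivable1_diffP; have [] := D t.
rewrite in_itv /= => c01; rewrite scale1r scale0r addr0 subrKC subr0 mulr1 => ->.
rewrite derive_grad// dotvE mulr_suml; apply: le_trans (ler_norm_sum _ _ _) _.
apply: ler_sum => i _; rewrite normrM; apply: ler_pM => //.
  by rewrite mxE ltW// xr//; apply: ball_segment.
rewrite [leRHS]mx_normrE.
by apply: (@le_bigmax_cond _ _ _ _ (i, 0) xpredT (fun ij => `|(a - b) ij.1 ij.2|)).
Qed.

Lemma locally_lipschitzN (R : realType) (X : normedModType R) (g : X -> R) x :
  locally_lipschitz_at g x -> locally_lipschitz_at (fun z => - g z) x.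
Proof.
move=> [L [r [L0 r0 gL]]]; exists L, r; split => // a b xa xb.
by rewrite -opprD normrN; exact: gL.
Qed.

Lemma locally_lipschitz_continuous (R : realType) (X : normedModType R)
    (g : X -> R) x :
  locally_lipschitz_at g x -> {for x, continuous g}.
Proof.
move=> [L [r [L0 r0 gL]]]; apply/cvgrPdist_lt => e e0.
have L1 : 0 < L + 1 by lra.
apply/nbhs_ballP; exists (Num.min r (e / (L + 1))) => /=.
  by rewrite lt_min r0 divr_gt0.
move=> z xz; have [zr ze] : ball x r z /\ ball x (e / (L + 1)) z.
  by split; apply: le_ball xz; rewrite ge_min lexx ?orbT.
apply: le_lt_trans (gL _ _ (ballxx _ r0) zr) _.
move: ze; rewrite -ball_normE /= ltr_pdivlMr// => ze.
have : 0 <= `|x - z| by []. lra.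
Qed.

(** * Monotonicity along absolutely continuous curves *)

Lemma abs_cont_uniform (R : realType) (Y : normedModType R) (a b e : R)
    (y : R -> Y) :
  abs_cont a b y -> 0 < e -> exists2 d : R, 0 < d &
    forall s t, a <= s <= b -> a <= t <= b -> `|t - s| < d -> `|y t - y s| < e.
Proof.
move=> acy e0; have [d d0 yd] := abs_cont_pairwise acy e0; exists d => //.
suff wl s t : a <= s -> s <= t -> t <= b -> `|t - s| < d -> `|y t - y s| < e.
  move=> s t /andP[as_ sb] /andP[at_ tb] st.
  have [le_st|/ltW le_ts] := leP s t; first exact: wl.
  by rewrite distrC; apply: wl; rewrite // distrC.
move=> as_ st tb; rewrite ger0_norm ?subr_ge0// => std.
have := yd [:: (s, t)]; rewrite !big_seq1 /=; apply => //.
by move=> p; rewrite inE => /eqP ->.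
Qed.

Lemma ae_imply (R : realType) (P Q : set R) :
  (forall x, P x -> Q x) -> (\forall x \ae (@lebesgue_measure R), P x) ->
  \forall x \ae (@lebesgue_measure R), Q x.
Proof.
exact: (@filterS _ _ (@ae_filter_ringOfSetsType _ _ _ (@lebesgue_measure R))).
Qed.

Lemma ae_imply2 (R : realType) (P Q S : set R) :
  (forall x, P x -> Q x -> S x) -> (\forall x \ae (@lebesgue_measure R), P x) ->
  (\forall x \ae (@lebesgue_measure R), Q x) ->
  \forall x \ae (@lebesgue_measure R), S x.
Proof.
exact: (@filterS2 _ _ (@ae_filter_ringOfSetsType _ _ _ (@lebesgue_measure R))).
Qed.

(** The Lipschitz bounds give absolute continuity of [g \o y] only near each time; a second Cousin
    induction glues the local inequalities by transitivity. *)
Lemma abs_cont_comp_le (R : realType) (Y : normedModType R) (a b : R)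
    (y : R -> Y) (g : Y -> R) :
  a <= b -> abs_cont a b y ->
  (forall x, a <= x <= b -> locally_lipschitz_at g (y x)) ->
  (\forall x \ae (@lebesgue_measure R), a <= x <= b ->
     exists2 d, is_derive x 1 (g \o y) d & 0 <= d) ->
  g (y a) <= g (y b).
Proof.
move=> ab acy gl gae.
apply: (@cousin_induction R (fun s t => g (y s) <= g (y t))) => //.
  by move=> s m t _ _ _ _; exact: le_trans.
move=> x xab; have [L [r [L0 r0 gL]]] := gl x xab.
have [d d0 yd] := abs_cont_uniform acy r0.
move: (xab) => /andP[ax xb].
exists d => // s t as_ sx xt tb ds dt.
apply: (@abs_cont_ge0_derive _ s t (g \o y)); first exact: le_trans xt.
  apply: (@abs_cont_lipschitz _ _ a b _ _ L y) => // p q sp pq qt.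
  have yball z : s <= z -> z <= t -> ball (y x) r (y z).
    move=> sz zt; rewrite -ball_normE /= distrC; apply: yd => //.
      by apply/andP; split; lra.
    by rewrite ltr_norml; apply/andP; split; lra.
  by apply: gL; apply: yball; lra.
apply: ae_imply gae => z hz /andP[sz zt]; apply: hz.
by apply/andP; split; lra.
Qed.

Lemma abs_cont_comp_ge (R : realType) (Y : normedModType R) (a b : R)
    (y : R -> Y) (g : Y -> R) :
  a <= b -> abs_cont a b y ->
  (forall x, a <= x <= b -> locally_lipschitz_at g (y x)) ->
  (\forall x \ae (@lebesgue_measure R), a <= x <= b ->
     exists2 d, is_derive x 1 (g \o y) d & d <= 0) ->
  g (y b) <= g (y a).
Proof.
move=> ab acy gl gae; rewrite -lerN2.
apply: (@abs_cont_comp_le _ _ a b y (fun z => - g z)) => //.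
  by move=> x xab; apply: locally_lipschitzN; exact: gl.
apply: ae_imply gae => x gx xab; have [d gd d0] := gx xab.
by exists (- d); [exact: is_deriveN | rewrite oppr_ge0].
Qed.

Lemma ae_neq (R : realType) (s : R) :
  \forall x \ae (@lebesgue_measure R), x != s.
Proof.
exists [set s]; split; [exact: measurable_set1 | exact: lebesgue_measure_set1 |].
by move=> x /= /negP; rewrite negbK => /eqP.
Qed.

(** The supremum of the times with [h <= 0] belongs to them, positivity being an open condition.
    This isolates a final interval on which a switching function has a strict sign. *)
Lemma last_le0 (R : realType) (h : R -> R) (a b : R) :
  a <= b -> h a <= 0 ->
  (forall x, a <= x <= b -> 0 < h x -> exists2 r : R, 0 < r &
     forall s, a <= s <= b -> `|s - x| < r -> 0 < h s) ->
  exists s, [/\ a <= s <= b, h s <= 0 & forall r, s < r <= b -> 0 < h r].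
Proof.
move=> ab ha hc; pose S := [set x | a <= x <= b /\ h x <= 0].
have Sa : S a by split=> //; rewrite lexx ab.
have ubS : ubound S b by move=> x [/andP[]].
have supS : has_sup S by split; [exists a | exists b].
have le_supS x : S x -> x <= sup S by apply: ub_le_sup; exists b.
have acb : a <= sup S <= b.
  by rewrite le_supS//=; apply: ge_sup => //; exists a.
exists (sup S); split => //.
  rewrite leNgt; apply/negP => /(hc _ acb)[r r0 hr].
  have [s Ss rs] := sup_adherent r0 supS; have ss := le_supS _ Ss.
  have [sab hs] := Ss; have : 0 < h s by apply: hr; rewrite // ltr_norml; lra.
  lra.
move=> r /andP[sr rb]; rewrite ltNge; apply/negP => hr.
suff : r <= sup S by lra.
by apply: le_supS; split => //; rewrite rb andbT; lra.
Qed.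

(** * Derivatives along a trajectory *)

(** A nonzero row vector [v] in the left kernel of [A] would give [v A v^T = 0]. *)
Lemma posdef_unitmx (R : realType) n (A : 'M[R]_n) : posdef A -> A \in unitmx.
Proof.
move=> Apos; rewrite -row_free_unit -kermx_eq0; apply: contraT => /rowV0Pn[v].
move=> /sub_kermxP vA v0; have := Apos v^T.
by rewrite /dotv trmxK mulmxA vA mul0mx mxE ltxx trmx_eq0 => /(_ v0).
Qed.

(** With [w = M^-1 n], symmetry turns [n^T M^-1 n] into [w^T M w], and [w] is nonzero because
    [n = M w]. *)
Lemma Dfun_gt0 (R : realType) n (M : 'cV[R]_n -> 'M[R]_n) (fc : 'cV[R]_n -> R) q :
  (M q)^T = M q -> posdef (M q) -> nvec fc q != 0 -> 0 < Dfun M fc q.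
Proof.
move=> Msym Mpos n0; have Munit := posdef_unitmx Mpos.
set w := invmx (M q) *m nvec fc q.
have Mw : M q *m w = nvec fc q by rewrite mulKVmx.
have -> : Dfun M fc q = dotv w (M q *m w).
  by rewrite /Dfun -/w -{1}Mw /dotv trmx_mul Msym mulmxA.
by apply: Mpos; apply: contraNneq n0 => w0; rewrite -Mw w0 mulmx0.
Qed.

Lemma is_derive_cvg (R : realType) (X : normedModType R) (f : R -> X) (x : R) d :
  (h^-1 *: ((f \o shift x) (h *: 1) - f x) @[h --> 0^'] --> d) ->
  is_derive x 1 f d.
Proof. by move=> fd; split; [exact: cvgP fd | exact: cvg_lim fd]. Qed.

(** A linear map commutes with difference quotients, and continuity at [d] passes to the limit; it
    serves the projections and matrix entries. *)
Lemma is_derive_linear_comp (R : realType) (X Y : normedModType R)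
    (l : X -> Y) (f : R -> X) (x : R) d :
  (forall k a b, l (k *: (a - b)) = k *: (l a - l b)) ->
  {for d, continuous l} ->
  is_derive x 1 f d -> is_derive x 1 (l \o f) (l d).
Proof.
move=> llin lc [df fd]; apply: is_derive_cvg.
have H : (h^-1 *: ((f \o shift x) (h *: 1) - f x) @[h --> 0^'] --> d).
  by rewrite -fd; exact: df.
have := cvg_comp _ _ H lc; apply: cvg_trans.
by apply: near_eq_cvg; near=> h => /=; rewrite llin.
Unshelve. all: by end_near. Qed.

Lemma is_derive_fst (R : realType) (X Y : normedModType R) (f : R -> X * Y) (x : R) d :
  is_derive x 1 f d -> is_derive x 1 (fun s => (f s).1) d.1.
Proof.
apply: (@is_derive_linear_comp R (X * Y)%type X fst f x d); last exact: cvg_fst.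
by move=> k [a1 a2] [b1 b2].
Qed.

Lemma is_derive_snd (R : realType) (X Y : normedModType R) (f : R -> X * Y) (x : R) d :
  is_derive x 1 f d -> is_derive x 1 (fun s => (f s).2) d.2.
Proof.
apply: (@is_derive_linear_comp R (X * Y)%type Y snd f x d); last exact: cvg_snd.
by move=> k [a1 a2] [b1 b2].
Qed.

Lemma is_derive_coord (R : realType) m n (f : R -> 'M[R]_(m, n)) (x : R) d i j :
  is_derive x 1 f d -> is_derive x 1 (fun s => f s i j) (d i j).
Proof.
apply: (@is_derive_linear_comp R 'M[R]_(m, n) R (fun A => A i j) f x d).
  by move=> k a b; rewrite !mxE.
exact: coord_continuous.
Qed.

Lemma is_derive_comp_curve (R : realType) (X : normedModType R) (q : R -> X)
    (g : X -> R) (x : R) d :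
  is_derive x 1 q d -> differentiable g (q x) ->
  is_derive x 1 (g \o q) ('D_d g (q x)).
Proof.
move=> [/derivable1_diffP dq qd] dg.
have dgq : differentiable (g \o q) x by exact: differentiable_comp.
split; first exact/derivable1_diffP.
by rewrite deriveE// diff_comp//= -qd (deriveE _ dq) deriveE.
Qed.

Lemma C2_gradient (R : realType) n (fc : 'cV[R]_n -> R) : C2 fc ->
  forall i q, differentiable (fun q' => nvec fc q' i 0) q.
Proof.
move=> [_ [dD _]] i q.
rewrite (_ : (fun _ => _) = 'D_(delta_mx i 0) fc); first exact: dD.
by apply/funext => q'; rewrite mxE.
Qed.

Section Switching.
Context (R : realType) (n : nat) (fc : 'cV[R]_n -> R) (fcC2 : C2 fc).
Local Notation state := ('cV[R]_n * 'cV[R]_n * R)%type.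
Context (y : R -> state) (tau : R) (dy : state) (ydy : is_derive tau 1 y dy).

Lemma is_derive_position : is_derive tau 1 (fun s => (y s).1.1) dy.1.1.
Proof. exact: is_derive_fst (is_derive_fst ydy). Qed.

Lemma is_derive_velocity i : is_derive tau 1 (fun s => (y s).1.2 i 0) (dy.1.2 i 0).
Proof. exact: is_derive_coord (is_derive_snd (is_derive_fst ydy)). Qed.

Lemma is_derive_c1 : is_derive tau 1 (c1 fc \o y) (dotv (nvec fc (y tau).1.1) dy.1.1).
Proof.
have [dfc _] := fcC2.
rewrite -(derive_grad dy.1.1 (dfc (y tau).1.1)).
exact: (is_derive_comp_curve is_derive_position).
Qed.

(** The product rule in each coordinate. Differentiating the normal along the position with the
    velocity frozen produces the gradient term of [phi]. *)
Lemma is_derive_c2 : is_derive tau 1 (c2 fc \o y)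
  (dotv (grad (fun q => dotv (nvec fc q) (y tau).1.2) (y tau).1.1) dy.1.1 +
   dotv (nvec fc (y tau).1.1) dy.1.2).
Proof.
pose N i q := nvec fc q i 0.
have dN i q : differentiable (N i) q by exact: C2_gradient.
have NV v q w : is_derive q w (fun q' => dotv (nvec fc q') v)
    (\sum_i 'D_w (N i) q * v i 0).
  rewrite (_ : (fun _ => _) = \sum_i (v i 0 \*: N i)).
    apply: is_derive_eq; last by apply: eq_bigr => i _; rewrite mulrC.
    apply: is_derive_sum => i; apply: is_deriveZ; apply: derivableP.
    exact: diff_derivable.
  apply/funext => q'; rewrite dotvE fct_sumE; apply: eq_bigr => i _.
  by rewrite mulrC.
have DNV v q : differentiable (fun q' => dotv (nvec fc q') v) q.
  rewrite (_ : (fun _ => _) = \sum_i (v i 0 \*: N i)).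
    by apply: differentiable_sum => i; exact: differentiableZ.
  apply/funext => q'; rewrite dotvE fct_sumE; apply: eq_bigr => i _.
  by rewrite mulrC.
rewrite -derive_grad// (@derive_val _ _ _ _ _ _ _ (NV _ _ _)) dotvE -big_split /=.
rewrite (_ : c2 fc \o y =
  \sum_i ((N i \o (fun s => (y s).1.1)) \* (fun s => (y s).1.2 i 0))); last first.
  by apply/funext => s; rewrite fct_sumE /= /c2 dotvE.
apply: is_derive_sum => i.
have H1 := is_derive_comp_curve is_derive_position (dN i _).
have H2 := is_derive_velocity i.
apply: is_derive_eq.
by rewrite addrC; congr (_ + _); rewrite mulrC.
Qed.

End Switching.

(** * Invariance of the sliding surface *)

(* h1, h2 are the switching functions along a trajectory; th, p, k stand for the
   multiplier of f_1, for phi and for D an *)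
Definition sliding_flow (R : realType) (h1 h2 : R -> R) (x : R) : Prop :=
  exists th p k : R, [/\ 0 <= th <= 1, p <= 0 & 0 <= k] /\
    [/\ is_derive x 1 h1 (th * h2 x), is_derive x 1 h2 (th * p + (1 - th) * k),
        h1 x < 0 -> h2 x < 0 -> th = 0 & 0 < h2 x -> th = 1].

Lemma sliding_invariance (R : realType) (Y : normedModType R) (y : R -> Y)
    (g1 g2 : Y -> R) (T : R) :
  abs_cont 0 T y ->
  (forall z, locally_lipschitz_at g1 z) -> (forall z, locally_lipschitz_at g2 z) ->
  g1 (y 0) = 0 -> g2 (y 0) = 0 ->
  (\forall x \ae (@lebesgue_measure R), 0 <= x <= T ->
     sliding_flow (g1 \o y) (g2 \o y) x) ->
  forall t, 0 <= t <= T -> g1 (y t) = 0 /\ g2 (y t) = 0.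
Proof.
move=> acy L1 L2 g10 g20 flow.
have acsub s t : 0 <= s -> t <= T -> abs_cont s t y.
  move=> s0 tT e e0; have [d d0 yd] := acy e e0; exists d => // k p pst; apply: yd => i.
  by have [? [? ?]] := pst i; split; [|split] => //; lra.
have last g (Lg : forall z, locally_lipschitz_at g z) t : 0 <= t <= T -> g (y 0) = 0 ->
    exists s, [/\ 0 <= s <= t, g (y s) <= 0 & forall r, s < r <= t -> 0 < g (y r)].
  move=> /andP[t0 tT] g0; apply: (@last_le0 _ (g \o y)) => //=; first by rewrite g0.
  move=> x xt gx.
  have /cvgrPdist_lt/(_ _ gx)/nbhs_ballP[e /= e0 He] := locally_lipschitz_continuous (Lg (y x)).
  have [d d0 yd] := abs_cont_uniform (acsub 0 t (lexx 0) tT) e0.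
  exists d => // s st sx; have : ball (y x) e (y s).
    by rewrite -ball_normE /= distrC; exact: yd.
  by move=> /He /=; rewrite ltr_norml; lra.
(* After the last time [s] with [g2 <= 0] the multiplier is 1, so [g2] has derivative [p <= 0]
   almost everywhere and cannot end positive. *)
have g2le t : 0 <= t <= T -> g2 (y t) <= 0.
  move=> tT; rewrite leNgt; apply/negP => gt0.
  have [s [/andP[s0 st] gs gr]] := last _ L2 t tT g20.
  suff : g2 (y t) <= g2 (y s) by lra.
  apply: (@abs_cont_comp_ge _ _ s t y g2) => //; first by apply: acsub => //; lra.
  apply: (ae_imply2 _ flow (ae_neq s)) => x xflow xs /andP[sx xt].
  have [|th [p [k [[_ p0 _] [_ d2 _ th1]]]]] := xflow; first by apply/andP; split; lra.
  eexists; first exact: d2.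
  by rewrite th1; [lra | apply: gr; rewrite lt_neqAle eq_sym xs sx].
have g1ge s t : 0 <= s -> s <= t -> t <= T -> g1 (y t) <= g1 (y s).
  move=> s0 st tT; apply: (@abs_cont_comp_ge _ _ s t y g1) => //; first exact: acsub.
  apply: ae_imply flow => x xflow /andP[sx xt].
  have xT : 0 <= x <= T by apply/andP; split; lra.
  have [th [p [k [[/andP[th0 _] _ _] [d1 _ _ _]]]]] := xflow xT.
  by eexists; [exact: d1 | rewrite mulr_ge0_le0//; exact: g2le].
have g1le t : 0 <= t <= T -> g1 (y t) <= 0.
  by move=> /andP[t0 tT]; rewrite -g10; exact: g1ge.
have g2eq t : 0 <= t <= T -> g2 (y t) = 0.
  move=> tT; apply/eqP; rewrite eq_le g2le//= leNgt; apply/negP => gt0.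
  (* Symmetrically, [s] is the last time with [g2 >= 0], found by applying [last] to the opposite of
     [g2]. *)
  have [|s [/andP[s0 st] gs gr]] := last _ (fun z => locally_lipschitzN (L2 z)) t tT.
    by rewrite g20 oppr0.
  suff : g2 (y s) <= g2 (y t) by lra.
  apply: (@abs_cont_comp_le _ _ s t y g2) => //; first by apply: acsub => //; lra.
  have flow_neq := ae_imply2 (fun x => @conj _ _) flow (ae_neq s).
  apply: (ae_imply2 _ flow_neq (ae_neq t)) => x [xflow xs] xt' /andP[sx xt].
  have xT : 0 <= x <= T by apply/andP; split; lra.
  have g2x : g2 (y x) < 0.
    by rewrite -oppr_gt0; apply: gr; rewrite lt_neqAle eq_sym xs sx.
  have [th [p [k [[/andP[th0 _] _ k0] [d1 d2 thm _]]]]] := xflow xT.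
  suff th_eq0 : th = 0.
    by eexists; [exact: d2 | rewrite th_eq0 mul0r add0r subr0 mul1r].
  have [g1x|g1x] := ltP (g1 (y x)) 0; first exact: thm.
  have g1x0 : g1 (y x) = 0 by apply/eqP; rewrite eq_le g1x g1le.
  (* Here [g1] attains its upper bound 0 at a time strictly between [s] and [t]; the endpoints were
     discarded as null sets for this purpose. *)
  have /eqP : th * (g2 \o y) x = 0.
    apply: (is_derive_interior_max d1 (a := s) (b := t)).
      by rewrite !lt_neqAle sx xt xt' eq_sym xs.
    move=> z /andP[sz zt]; rewrite /= g1x0; apply: g1le; apply/andP; split; lra.
  by rewrite mulf_eq0 /= (lt_eqF g2x) orbF => /eqP.
move=> t tT; split; last exact: g2eq.
have /andP[t0 tT'] := tT; apply/eqP; rewrite eq_le g1le//= -{1}g10.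
apply: (@abs_cont_comp_le _ _ 0 t y g1) => //; first exact: acsub.
apply: ae_imply flow => x xflow /andP[x0 xt].
have xT : 0 <= x <= T by apply/andP; split; lra.
have [th [p [k [_ [d1 _ _ _]]]]] := xflow xT.
by eexists; [exact: d1 | rewrite /= g2eq// mulr0].
Qed.

(** * Regularity of the switching functions and closures of the regions *)

Section Regions.
Context (R : realType) (n : nat) (fc : 'cV[R]_n -> R) (fcC2 : C2 fc).
Local Notation state := ('cV[R]_n * 'cV[R]_n * R)%type.

Lemma locally_lipschitz_position (g : 'cV[R]_n -> R) (z : state) :
  locally_lipschitz_at g z.1.1 -> locally_lipschitz_at (fun z' : state => g z'.1.1) z.
Proof.
apply: (@locally_lipschitz_comp R state _ (fun z' => z'.1.1) g) => a b.
by rewrite [leRHS]prod_normE le_max [X in _ <= X]prod_normE le_max lexx.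
Qed.

Lemma locally_lipschitz_velocity i (z : state) :
  locally_lipschitz_at (fun z' : state => z'.1.2 i 0) z.
Proof.
exists 1, 1; split => // a b _ _; rewrite mul1r.
rewrite [leRHS]prod_normE le_max [X in (_ <= X) || _]prod_normE le_max.
apply/orP; left; apply/orP; right; rewrite [leRHS]mx_normrE.
have -> : a.1.2 i 0 - b.1.2 i 0 = (a - b).1.2 i 0 by rewrite !mxE.
by apply: (@le_bigmax_cond _ _ _ _ (i, 0) xpredT (fun ij => `|(a - b).1.2 ij.1 ij.2|)).
Qed.

Lemma locally_lipschitz_c1 (z : state) : locally_lipschitz_at (c1 fc) z.
Proof.
have [dfc [dD _]] := fcC2; apply: locally_lipschitz_position.
by apply: locally_lipschitz_C1 => // e q; exact: differentiable_continuous.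
Qed.

(** Each summand is a partial derivative of [fc], itself C1 because [fc] is C2, times a velocity
    coordinate. *)
Lemma locally_lipschitz_c2 (z : state) : locally_lipschitz_at (c2 fc) z.
Proof.
have [_ [dD cD]] := fcC2.
rewrite (_ : c2 fc = fun z' => \sum_i ('D_(delta_mx i 0) fc z'.1.1 * z'.1.2 i 0)).
  apply: locally_lipschitz_sum => i; apply: locally_lipschitzM.
    apply: (@locally_lipschitz_position ('D_(delta_mx i 0) fc)).
    exact: locally_lipschitz_C1.
  exact: locally_lipschitz_velocity.
by apply/funext => z'; rewrite /c2 dotvE; apply: eq_bigr => i _; rewrite mxE.
Qed.

(** Both strict inequalities persist near [z] by continuity, and together they exclude membership in
    [Reg1]. *)
Lemma not_closure_Reg1 (z : state) :
  c1 fc z < 0 -> c2 fc z < 0 -> ~ closure (Reg1 fc) z.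
Proof.
move=> z1 z2 /(_ [set z' | c1 fc z' < 0 /\ c2 fc z' < 0])[].
  apply: filterI.
    exact: (cvgr_lt _ (locally_lipschitz_continuous (locally_lipschitz_c1 z))).
  exact: (cvgr_lt _ (locally_lipschitz_continuous (locally_lipschitz_c2 z))).
move=> z' [[/=|[/=]]]; first by move=> + [+ _]; lra.
by move=> _ + [_ +]; lra.
Qed.

Lemma not_closure_Reg2 (z : state) : 0 < c2 fc z -> ~ closure (Reg2 fc) z.
Proof.
move=> z2 /(_ [set z' | 0 < c2 fc z'])[].
  exact: (cvgr_gt _ (locally_lipschitz_continuous (locally_lipschitz_c2 z))).
by move=> z' [[_ /=]]; lra.
Qed.

End Regions.

(** * Sliding dynamics *)

Lemma dotvD (R : realType) n (a b c : 'cV[R]_n) : dotv a (b + c) = dotv a b + dotv a c.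
Proof. by rewrite /dotv mulmxDr mxE. Qed.

Lemma dotvZ (R : realType) n k (a b : 'cV[R]_n) : dotv a (k *: b) = k * dotv a b.
Proof. by rewrite /dotv -scalemxAr mxE. Qed.

Lemma is_derive_derive1 (R : realType) (X : normedModType R) (f : R -> X) (x : R) :
  derivable f x 1 -> is_derive x 1 f (f^`()%classic x).
Proof. by move=> df; split; [exact: df | rewrite derive1E]. Qed.

Section Dynamics.
Context (R : realType) (nq nu : nat).
Context (fv : 'cV[R]_nq -> 'cV[R]_nq -> 'cV[R]_nu -> 'cV[R]_nq).
Context (M : 'cV[R]_nq -> 'M[R]_nq) (fc : 'cV[R]_nq -> R) (an : R).
Context (y : R -> 'cV[R]_nq * 'cV[R]_nq * R) (tau : R) (w : 'cV[R]_nu).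
Context (fcC2 : C2 fc) (y_derivable : derivable y tau 1).
Local Notation q := (y tau).1.1.
Local Notation v := (y tau).1.2.

(** The auxiliary field does not move the position, so only [f1] contributes. *)
Lemma is_derive_c1_flow th1 th2 :
  (y^`() tau)%classic = th1 *: f1 fv (y tau) w + th2 *: f2 M fc an (y tau) ->
  is_derive tau 1 (c1 fc \o y) (th1 * c2 fc (y tau)).
Proof.
move=> dyE; have ydy := is_derive_derive1 y_derivable.
apply: is_derive_eq (is_derive_c1 fcC2 ydy) _.
by rewrite dyE /= scaler0 addr0 dotvZ.
Qed.

(** The field [f1] contributes [phi]; the auxiliary field contributes [n^T M^-1 n an], which is
    [D an]. *)
Lemma is_derive_c2_flow th1 th2 :
  (y^`() tau)%classic = th1 *: f1 fv (y tau) w + th2 *: f2 M fc an (y tau) ->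
  is_derive tau 1 (c2 fc \o y)
    (th1 * phi fv fc q v w + th2 * (Dfun M fc q * an)).
Proof.
move=> dyE; have ydy := is_derive_derive1 y_derivable.
apply: is_derive_eq (is_derive_c2 fcC2 ydy) _.
rewrite dyE /= scaler0 addr0 dotvD !dotvZ mul_mx_scalar dotvZ /phi /Dfun.
by ring.
Qed.

Lemma gamma_bounds : 0 < Dfun M fc q * an -> phi fv fc q v w <= 0 ->
  0 < gamma fv M fc an q v w <= 1.
Proof.
move=> Da ph; have d0 : 0 < Dfun M fc q * an - phi fv fc q v w by lra.
by rewrite /gamma divr_gt0//= ler_pdivrMr// mul1r; lra.
Qed.

Lemma sliding_multiplier th1 th2 :
  0 < Dfun M fc q * an -> phi fv fc q v w <= 0 -> th1 + th2 = 1 ->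
  th1 * phi fv fc q v w + th2 * (Dfun M fc q * an) = 0 ->
  th1 = gamma fv M fc an q v w.
Proof.
move=> Da ph th12 th0; rewrite /gamma.
have d0 : Dfun M fc q * an - phi fv fc q v w != 0 by rewrite gt_eqF//; lra.
apply: (mulIf d0); rewrite divfK//.
have th2E : th2 = 1 - th1 by lra.
by move: th0; rewrite th2E; lra.
Qed.

(** Tangency gives [th2 * an = - th1 * phi / D], so the auxiliary acceleration becomes [th1] times
    the constraint force of the DAE. Position and clock already move with [f1] alone. *)
Lemma sliding_dynamics th1 th2 :
  Dfun M fc q != 0 -> th1 * phi fv fc q v w + th2 * (Dfun M fc q * an) = 0 ->
  th1 *: f1 fv (y tau) w + th2 *: f2 M fc an (y tau) =
  th1 *: (fDAE fv M fc q v w, 1).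
Proof.
move=> D0 th0; apply/pair_equal_spec; split; last by rewrite /= scaler0 addr0.
apply/pair_equal_spec; split; first by rewrite /= scaler0 addr0.
rewrite /= mul_mx_scalar -scalemxAr mul_mx_scalar scalerBr !scalerA -scaleNr.
congr (_ + _ *: _).
have -> : th2 * an = th2 * (Dfun M fc q * an) / Dfun M fc q by field.
have -> : th2 * (Dfun M fc q * an) = - (th1 * phi fv fc q v w) by lra.
by field.
Qed.

End Dynamics.

Theorem theorem1 (R : realType) (nq nu : nat)
  (fv : 'cV[R]_nq -> 'cV[R]_nq -> 'cV[R]_nu -> 'cV[R]_nq)
  (M : 'cV[R]_nq -> 'M[R]_nq) (fc : 'cV[R]_nq -> R) (an : R)
  (u : R -> 'cV[R]_nu) (tauf : R)
  (y : R -> 'cV[R]_nq * 'cV[R]_nq * R) :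
  C2 (fun p : 'cV[R]_nq * 'cV[R]_nq * 'cV[R]_nu => fv p.1.1 p.1.2 p.2) ->
  C2 M -> C2 fc ->
  (forall q, (M q)^T = M q) -> (forall q, posdef (M q)) ->
  0 < an ->
  (forall tau, 0 <= tau <= tauf -> nvec fc (y tau).1.1 != 0) ->
  TF_solution fv M fc an u tauf y ->
  Sigma fc (y 0) ->
  (forall tau, 0 <= tau <= tauf -> phi fv fc (y tau).1.1 (y tau).1.2 (u tau) <= 0) ->
  (* (i) uniqueness of the convex multipliers *)
  (\forall tau \ae (@lebesgue_measure R), 0 <= tau <= tauf ->
     forall th1 th2 th1' th2' : R,
       0 <= th1 -> 0 <= th2 -> th1 + th2 = 1 ->
       y^`() tau = th1 *: f1 fv (y tau) (u tau) + th2 *: f2 M fc an (y tau) ->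
       0 <= th1' -> 0 <= th2' -> th1' + th2' = 1 ->
       y^`() tau = th1' *: f1 fv (y tau) (u tau) + th2' *: f2 M fc an (y tau) ->
       th1 = th1' /\ th2 = th2')
  /\
  (* (ii) the solution is a sliding mode on Sigma with the rescaled DAE dynamics *)
  (forall tau, 0 <= tau <= tauf -> Sigma fc (y tau))
  /\
  (\forall tau \ae (@lebesgue_measure R), 0 <= tau <= tauf ->
     y^`() tau = gamma fv M fc an (y tau).1.1 (y tau).1.2 (u tau) *:
                 (fDAE fv M fc (y tau).1.1 (y tau).1.2 (u tau), 1))
  /\
  (forall tau, 0 <= tau <= tauf ->
     0 < gamma fv M fc an (y tau).1.1 (y tau).1.2 (u tau) <= 1).
Proof.
move=> _ _ fcC2 Msym Mpos an0 n0 [acy flow] [y01 y02] phi0.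
have Da0 tau : 0 <= tau <= tauf -> 0 < Dfun M fc (y tau).1.1 * an.
  by move=> ht; rewrite mulr_gt0// Dfun_gt0//; exact: n0.
have slide : forall tau, 0 <= tau <= tauf -> Sigma fc (y tau).
  apply: (@sliding_invariance _ _ y (c1 fc) (c2 fc) tauf) => //.
  - exact: locally_lipschitz_c1.
  - exact: locally_lipschitz_c2.
  apply: ae_imply flow => tau ht tauI.
  have [dy [th1 [th2 [[th1_ge0 th2_ge0 th12] [out1 out2 dyE]]]]] := ht tauI.
  exists th1, (phi fv fc (y tau).1.1 (y tau).1.2 (u tau)), (Dfun M fc (y tau).1.1 * an).
  have -> : 1 - th1 = th2 by lra.
  split; first by split; [apply/andP; split; lra | exact: phi0 | exact/ltW/Da0].
  split; [exact: is_derive_c1_flow dyE | exact: is_derive_c2_flow dyE | |].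
    by move=> z1 z2; apply: out1; exact: not_closure_Reg1.
  (* Away from the closure of [Reg2] the multiplier [th2] vanishes, hence [th1 = 1]. *)
  by move=> z2; have := out2 (not_closure_Reg2 fcC2 z2); lra.
split; [|split; [exact: slide|split]].
(* The clock advances at rate 1 under [f1] and 0 under [f2], so the last component of the velocity
   is [th1] itself. *)
- apply: aeW => tau _ th1 th2 th1' th2' _ _ th12 -> _ _ th12' /(congr1 snd) /=.
  rewrite !scaler0 !addr0 => th1E.
  have {th1E} th1E : th1 = th1' by move: th1E; rewrite /GRing.scale /= !mulr1.
  by split => //; lra.
(* The endpoints are dropped so that [tau] is interior. Since [c2] vanishes along the whole
   trajectory, [tau] is a maximum of [c2 \o y], whose derivative is therefore 0; this equation
   determines [th1]. *)
- apply: (ae_imply2 _ flow (ae_imply2 (fun x => @conj _ _) (ae_neq 0) (ae_neq tauf))).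
  move=> tau ht [tau0 tauf0] tauI.
  have [dy [th1 [th2 [[_ _ th12] [_ _ dyE]]]]] := ht tauI.
  have dc2 := is_derive_c2_flow fcC2 dy dyE.
  have th0 := is_derive_interior_max dc2 (a := 0) (b := tauf).
  have {}th0 : th1 * phi fv fc (y tau).1.1 (y tau).1.2 (u tau) +
      th2 * (Dfun M fc (y tau).1.1 * an) = 0.
    apply: th0; first by rewrite !lt_neqAle eq_sym tau0 tauf0.
    by move=> z /slide[_]; have [_] := slide _ tauI; rewrite /= /c2 => -> ->.
  rewrite dyE (sliding_dynamics _ th0); last first.
    by have := Da0 _ tauI; rewrite pmulr_lgt0// => /gt_eqF ->.
  by rewrite (sliding_multiplier (Da0 _ tauI) (phi0 _ tauI) th12 th0).
- by move=> tau tauI; apply: gamma_bounds; [exact: Da0 | exact: phi0].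
Qed.
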